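(* Let $G=(V,E)$ be a partial cube obtained by vertex-pasting together partial cubes $G_1=(V_1,E_1)$ and $G_2=(V_2,E_2)$. Then $$\dim_I(G)=\dim_I(G_1)+\dim_I(G_2).$$
   Context: Graphs are simple, undirected, nonempty, and not necessarily finite. For a set $X$, the hypercube $\mathcal H(X)$ is the graph whose vertices are the finite subsets of $X$, with $P,Q$ adjacent iff $|P\Delta Q|=1$; its dimension is the cardinality $|X|$. A graph is a partial cube if it can be isometrically embedded (i.e. by a map preserving shortest-path distances) into some $\mathcal H(X)$. The isometric dimension $\dim_I(G)$ of a partial cube $G$ is the minimum possible dimension (a cardinal) of a hypercube $\mathcal H(X)$ into which $G$ is isometrically embeddable. Vertex-pasting: given connected graphs $G_1,G_2$ and vertices $a_1\in V_1$, $a_2\in V_2$, the graph obtained by vertex-pasting is the graph obtained from the disjoint union of $G_1$ and $G_2$ by identifying $a_1$ with $a_2$ (and making no other identifications). *)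

(* Defs.v *)
From mathcomp Require Import all_boot all_classical.

Set Implicit Arguments.
Unset Strict Implicit.
Unset Printing Implicit Defensive.

Local Open Scope classical_set_scope.
Local Open Scope card_scope.

Record graph := Graph {
  vertex :> Type;
  adj : vertex -> vertex -> Prop;
  adj_sym : forall x y, adj x y -> adj y x;
  adj_irrefl : forall x, ~ adj x x;
  graph_inhabited : inhabited vertex }.

Fixpoint walk (G : graph) (n : nat) (x y : G) : Prop :=
  if n is m.+1 then exists2 z, adj x z & walk m z y else x = y.

(* Shortest-path distance, with [None] standing for an infinite distance. *)
Definition dist (G : graph) (x y : G) : option nat :=
  if pselect (exists n, `[< walk n x y >]) is left h then Some (ex_minn h)
  else None.

Definition isometric (G H : graph) (f : G -> H) : Prop :=
  forall x y, dist (f x) (f y) = dist x y.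

Section Hypercube.
Variable X : Type.

Definition finite_subset := {P : set X | finite_set P}.

Definition hypercube_adj (P Q : finite_subset) : Prop :=
  sval P `+` sval Q #= `I_1.

Lemma hypercube_adj_sym P Q : hypercube_adj P Q -> hypercube_adj Q P.
Proof. by rewrite /hypercube_adj setYC. Qed.

Lemma hypercube_adj_irrefl P : ~ hypercube_adj P P.
Proof.
rewrite /hypercube_adj setYK card_eq_sym card_eq0 => /eqP I0.
by have : (set0 : set nat) 0 by rewrite -I0.
Qed.

Definition hypercube : graph :=
  Graph hypercube_adj_sym hypercube_adj_irrefl
    (inhabits (exist _ set0 (finite_set0 X))).

End Hypercube.

Definition embeds_in_hypercube (G : graph) (X : Type) : Prop :=
  exists f : G -> hypercube X, isometric f.

Definition partial_cube (G : graph) : Prop :=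
  exists X : Type, embeds_in_hypercube G X.

(* Any nonempty class of types has a member of least cardinality: take a
   maximal set of choice functions on which all projections are injective;
   one of the projections must then be surjective. *)
Lemma least_cardinality (P : Type -> Prop) : (exists X, P X) ->
  exists X, P X /\ forall Y, P Y -> [set: X] #<= [set: Y].
Proof.
move=> exP; pose I := {Y : Type | P Y}; pose T := forall i : I, sval i.
pose Q (F : set T) := forall f g, F f -> F g -> forall i, f i = g i -> f = g.
have [F QF totF|A [QA Amax]] := @Zorn_bigcup T Q.
  move=> f g [B FB Bf] [C FC Cg] i fg.
  have [BC|CB] := totF _ _ FB FC.
    exact: (QF _ FC f g (BC _ Bf) Cg i fg).
  exact: (QF _ FB f g Bf (CB _ Cg) i fg).
have [[i Ai]|noi] := pselect (exists i, forall y, exists f : T, A f /\ f i = y).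
  exists (sval i); split; first exact: svalP i.
  move=> Y PY; pose j : I := exist _ Y PY.
  have [h] : $|{injfun [set: sval i] >-> [set: Y]}|; last exact: inj_card_le h.
  apply/injfunPex; exists (fun y => sval (cid (Ai y)) j) => // y z _ _.
  case: (cid (Ai y)) (cid (Ai z)) => f [Af fy] [g [Ag gz]] /= fg.
  by rewrite -fy -gz (QA f g Af Ag j fg).
have miss i : {y : sval i | forall f : T, A f -> f i <> y}.
  apply: cid; apply: contrapT => H; apply: noi; exists i => y.
  apply: contrapT => H'; apply: H; exists y => f Af fy.
  by apply: H'; exists f.
pose f0 : T := fun i => sval (miss i).
have f0A f i : A f -> f i <> f0 i by exact: svalP (miss i) f.
exfalso; apply: (Amax (A `|` [set f0])).
  split; first by move=> f Af; left.
  case: exP => X PX /(_ f0 (or_intror erefl)) Af0.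
  exact: (f0A _ (exist _ X PX) Af0).
move=> f g [Af|->] [Ag|->] i // fg; first exact: (QA f g Af Ag i fg).
  by case: (f0A f i Af).
by case: (f0A g i Ag).
Qed.

Lemma dimI_exists (G : graph) : partial_cube G ->
  exists X, embeds_in_hypercube G X /\
    forall Y, embeds_in_hypercube G Y -> [set: X] #<= [set: Y].
Proof. exact: least_cardinality. Qed.

(* Cardinals are represented by types, and equality of cardinals by [#=]; the
   sum of the cardinals of X and Y is then the cardinal of the sum type X + Y.
   [dimI hG] is a chosen representative of the isometric dimension of G. *)
Definition dimI (G : graph) (hG : partial_cube G) : Type :=
  sval (cid (dimI_exists hG)).

Lemma dimIP (G : graph) (hG : partial_cube G) :
  embeds_in_hypercube G (dimI hG) /\
  forall Y, embeds_in_hypercube G Y -> [set: dimI hG] #<= [set: Y].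
Proof. exact: svalP (cid (dimI_exists hG)). Qed.

Section VertexPasting.
Variables (G1 G2 : graph) (a1 : G1) (a2 : G2).

Definition disjoint_union_adj (u v : G1 + G2) : Prop :=
  match u, v with
  | inl x, inl y => adj x y
  | inr x, inr y => adj x y
  | _, _ => False
  end.

Definition identified (u v : G1 + G2) : Prop :=
  [\/ u = v, u = inl a1 /\ v = inr a2 | u = inr a2 /\ v = inl a1].

(* G is (up to isomorphism) the quotient of the disjoint union of G1 and G2 by
   [identified], with quotient map p. *)
Definition vertex_pasting (G : graph) : Prop :=
  exists p : G1 + G2 -> G,
    [/\ forall s, exists u, p u = s,
        forall u v, p u = p v <-> identified u v &
        forall s t, adj s t <->
          exists u v, [/\ p u = s, p v = t & disjoint_union_adj u v]].

End VertexPasting.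

(* Main.v *)
(** A hypercube is connected, with distance [|P Δ Q|].  The two retractions
    [r1 : G -> G1] and [r2 : G -> G2] collapse the other factor to the pasting
    vertex, and every edge of [G] is collapsed by exactly one of them; hence
    [d (s, t) = d (r1 s, r1 t) + d (r2 s, r2 t)].  Embeddings of [G1] and [G2]
    in [H(X1)] and [H(X2)] therefore combine into one of [G] in [H(X1 + X2)].
    Conversely, given an embedding [f] of [G] in [H(X)], each [Gi] embeds in
    [H(Di)], where [Di] is the set of coordinates on which [f] varies over [Gi];
    additivity of the distance through the pasting vertex makes [D1] and [D2]
    disjoint, so [D1 + D2] injects into [X]. *)
Require Import Defs.
From mathcomp Require Import all_boot finmap all_classical.

Set Implicit Arguments.
Unset Strict Implicit.
Unset Printing Implicit Defensive.

Local Open Scope classical_set_scope.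
Local Open Scope card_scope.

(** * Cardinalities of finite sets as natural numbers *)

Lemma sval_inj (X : Type) (D : X -> Prop) : injective (@sval X D).
Proof. by move=> [x Dx] [y Dy] /= xy; exact: eq_exist. Qed.

(* Junk value: [ncard A = 0] when [A] is infinite. *)
Definition ncard (T : Type) (A : set T) : nat :=
  #|` fset_set (A : set {classic T})|%fset.

Lemma ncardP (T : Type) (A : set T) n :
  finite_set A -> (A #= `I_n) <-> ncard A = n.
Proof.
move=> finA; split; first exact: (@card_fset_set {classic T}).
move=> An; apply/(@fcard_eq {classic T} nat) => //.
by rewrite -/(ncard A) An; apply/esym/card_fset_set.
Qed.

Lemma ncardUI (T : Type) (A B : set T) : finite_set A -> finite_set B ->
  ncard (A `|` B) + ncard (A `&` B) = ncard A + ncard B.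
Proof.
move=> finA finB; rewrite /ncard (@fset_setU {classic T}) //.
by rewrite (@fset_setI {classic T}) // cardfsUI.
Qed.

Lemma ncardU_le (T : Type) (A B : set T) : finite_set A -> finite_set B ->
  ncard (A `|` B) <= ncard A + ncard B.
Proof. by move=> finA finB; rewrite -ncardUI // leq_addr. Qed.

Lemma ncard0 (T : Type) : ncard (@set0 T) = 0.
Proof. by rewrite /ncard (@fset_set0 {classic T}) cardfs0. Qed.

Lemma ncard_eq0 (T : Type) (A : set T) :
  finite_set A -> ncard A = 0 -> A = set0.
Proof. by move=> finA /(ncardP _ finA); rewrite II0 card_eq0 => /eqP. Qed.

Lemma ncard1 (T : Type) (x : T) : ncard [set x] = 1.
Proof. by rewrite /ncard (@fset_set1 {classic T}) cardfs1. Qed.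

Lemma subset_ncard (T : Type) (A B : set T) :
  finite_set B -> A `<=` B -> ncard A <= ncard B.
Proof.
move=> finB AB; have finA := sub_finite_set AB finB.
by apply/fsubset_leq_card; rewrite -(@fset_set_sub {classic T}).
Qed.

Lemma ncard_image (T U : Type) (f : T -> U) (A : set T) :
  injective f -> finite_set A -> ncard (f @` A) = ncard A.
Proof.
move=> fI finA; apply/ncardP; first exact: finite_image.
apply: card_eq_trans (_ : A #= _).
  by apply: inj_card_eq => x y _ _; exact: fI.
exact/ncardP.
Qed.

(** * Walks and distance *)

Section Distance.
Variable G : graph.
Implicit Types x y z : G.

Lemma distP x y n :
  dist x y = Some n <-> walk n x y /\ forall m, walk m x y -> n <= m.
Proof.
rewrite /dist; case: pselect => [h|noh]; last first.
  by split=> // -[w _]; case: noh; exists n; apply/asboolP.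
case: ex_minnP => k /asboolP wk kmin; split=> [[<-]|[w nmin]].
  by split=> // m wm; apply: kmin; apply/asboolP.
congr Some; apply/eqP; rewrite eqn_leq nmin // andbT.
by apply: kmin; apply/asboolP.
Qed.

Lemma distxx x : dist x x = Some 0.
Proof. exact/distP. Qed.

Lemma walk_cat m n x y z : walk m x y -> walk n y z -> walk (m + n) x z.
Proof.
elim: m x => [|m IH] x /=; first by move=> ->.
by case=> u xu uy yz; exists u => //; exact: IH.
Qed.

End Distance.

(** * Distance in a hypercube *)

Section HypercubeDistance.
Variable X : Type.
Implicit Types P Q R : hypercube X.

Lemma finite_setY (A B : set X) :
  finite_set A -> finite_set B -> finite_set (A `+` B).
Proof. by move=> finA finB; rewrite finite_setU; split; exact: finite_setD. Qed.

Lemma finite_setY_hypercube P Q : finite_set (sval P `+` sval Q).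
Proof. by apply: finite_setY; exact: svalP. Qed.
Local Hint Resolve finite_setY_hypercube : core.

Lemma hypercube_adjP P Q : adj P Q <-> ncard (sval P `+` sval Q) = 1.
Proof. exact: ncardP. Qed.

(** Set form of the triangle inequality for the size of a symmetric difference. *)
Lemma setY_sub_setU (A B C : set X) :
  A `+` C `<=` (A `+` B) `|` (B `+` C).
Proof.
move=> x; have [Bx|nBx] := pselect (B x).
  by move=> [[Ax nCx]|[Cx nAx]]; [right; left|left; right].
by move=> [[Ax nCx]|[Cx nAx]]; [left; left|right; right].
Qed.

Lemma walk_hypercube_ge n P Q : walk n P Q -> ncard (sval P `+` sval Q) <= n.
Proof.
elim: n P => [|n IH] P /= => [->|[R /hypercube_adjP PR /IH RQ]].
  by rewrite setYK ncard0.
apply: leq_trans (subset_ncard _ (@setY_sub_setU _ (sval R) _)) _.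
  by rewrite finite_setU.
by apply: leq_trans (ncardU_le _ _) _; rewrite // PR add1n ltnS.
Qed.

(** Toggle the elements of the symmetric difference one at a time; the induction is on its size,
    with [P] free. *)
Lemma walk_hypercube P Q : walk (ncard (sval P `+` sval Q)) P Q.
Proof.
move: {2}(ncard _) (erefl (ncard (sval P `+` sval Q))) => n.
elim: n P => [|n IH] P PQ; rewrite PQ /=.
  have YPQ := ncard_eq0 (finite_setY_hypercube P Q) PQ.
  apply: sval_inj.
  by rewrite -[sval P]setY0 -[in LHS](setYK (sval Q)) setYA YPQ set0Y.
have [x PQx] : (sval P `+` sval Q) !=set0.
  by apply/set0P/eqP => YPQ; rewrite YPQ ncard0 in PQ.
(* Toggling [x] in [P] is an edge, and since [x] lies in the difference with [Q], that difference
   loses exactly [x]. *)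
pose R : hypercube X :=
  exist _ (sval P `+` [set x]) (finite_setY (svalP P) (finite_set1 x)).
have PR : sval P `+` sval R = [set x] by rewrite /= setYA setYK set0Y.
have RQ : sval R `+` sval Q = (sval P `+` sval Q) `\ x.
  rewrite -setYD setIC; have /setIidPl -> : [set x] `<=` sval P `+` sval Q.
    by move=> _ ->.
  by rewrite /= -setYA [[set x] `+` _]setYC setYA.
exists R; first by apply/hypercube_adjP; rewrite PR ncard1.
have E : ncard (sval R `+` sval Q) = n.
  apply: (@addnI 1); rewrite [RHS]add1n -PQ -(ncard1 x) -ncardUI; last 2 first.
  - exact: finite_set1.
  - exact: finite_setY_hypercube.
  rewrite RQ setDUK; last by move=> _ ->.
  by rewrite setDIK ncard0 addn0.
by rewrite -[X in walk X]E; exact: IH.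
Qed.

Lemma dist_hypercube P Q : dist P Q = Some (ncard (sval P `+` sval Q)).
Proof.
apply/distP; split; first exact: walk_hypercube.
by move=> m; exact: walk_hypercube_ge.
Qed.

End HypercubeDistance.

(** * Isometric embeddings and the coordinates they use *)

Lemma isometricP (G : graph) (X : Type) (f : G -> hypercube X) :
  isometric f <->
  forall x y, dist x y = Some (ncard (sval (f x) `+` sval (f y))).
Proof. by split=> h x y; [rewrite -h|rewrite h]; rewrite dist_hypercube. Qed.

(** Partial cubes inherit connectedness from hypercubes, where no distance is [None]. *)
Lemma partial_cube_dist (H : graph) (x y : H) :
  partial_cube H -> exists n, dist x y = Some n.
Proof. by move=> [Y [g /isometricP ->]]; eexists. Qed.

(** The coordinates on which [f] is not constant; [a] serves only as a base point. *)
Definition varying (V X : Type) (f : V -> hypercube X) (a : V) : set X :=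
  [set x | exists u, (sval (f u) `+` sval (f a)) x].

(** A coordinate separating [f u] from [f v] separates one of them from [f a], so discarding the
    other coordinates leaves all distances unchanged. *)
Lemma embeds_in_varying (G : graph) (X : Type) (f : G -> hypercube X) (a : G) :
  isometric f -> embeds_in_hypercube G {x | varying f a x}.
Proof.
move=> /isometricP isof; pose D := varying f a.
have fin u : finite_set (@sval X D @^-1` sval (f u)).
  by apply: finite_preimage (svalP (f u)) => x y _ _; exact: sval_inj.
exists (fun u => exist _ _ (fin u)); apply/isometricP => u v.
rewrite isof; congr Some => /=.
rewrite -[RHS](ncard_image (@sval_inj _ D)); last exact: finite_setY.
congr ncard; apply/seteqP; split=> [x uvx|_ [z uvz <-]//].
suff Dx : D x by exists (exist _ x Dx).
by have [ua|av] := setY_sub_setU (sval (f a)) uvx;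
  [exists u|exists v; rewrite setYC].
Qed.

(** * Disjoint unions of finite sets *)

Section SumSet.
Variables X Y : Type.

(** The definition by cases, rather than by images, lets symmetric differences compute on each
    summand. *)
Definition sumset (A : set X) (B : set Y) : set (X + Y) :=
  fun z => match z with inl x => A x | inr y => B y end.

Lemma sumsetE A B : sumset A B = (inl @` A) `|` (inr @` B).
Proof.
apply/seteqP; split=> [[x|y] h|z [[x Ax <-]|[y By <-]]] //.
  by left; exists x.
by right; exists y.
Qed.

Lemma finite_sumset A B :
  finite_set A -> finite_set B -> finite_set (sumset A B).
Proof.
by move=> finA finB; rewrite sumsetE finite_setU; split; exact: finite_image.
Qed.

Lemma ncard_sumset A B : finite_set A -> finite_set B ->
  ncard (sumset A B) = ncard A + ncard B.
Proof.
move=> finA finB; rewrite -(ncard_image (inl_inj (B := Y)) finA).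
rewrite -(ncard_image (inr_inj (A := X)) finB) -ncardUI; last 2 first.
- exact: finite_image.
- exact: finite_image.
rewrite -sumsetE (_ : _ `&` _ = set0) ?ncard0 ?addn0 //.
by apply/seteqP; split=> // z [[x _ <-] [y _]].
Qed.

Lemma sumsetY A A' B B' :
  sumset A B `+` sumset A' B' = sumset (A `+` A') (B `+` B').
Proof. by apply/funext => -[x|y]. Qed.

End SumSet.

(** * Retractions and distance in a vertex-pasting *)

Section Pasting.
Variables (G1 G2 G : graph) (a1 : G1) (a2 : G2) (p : G1 + G2 -> G).
Hypothesis p_surj : forall s, exists u, p u = s.
Hypothesis p_ident : forall u v, p u = p v <-> identified a1 a2 u v.
Hypothesis p_adj : forall s t, adj s t <->
  exists u v, [/\ p u = s, p v = t & disjoint_union_adj u v].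

(** The chosen preimage of [s] is ambiguous only at the pasting vertex, where both [inl a1] and
    [inr a2] yield [a1]. *)
Definition retract1 (s : G) : G1 :=
  if sval (cid (p_surj s)) is inl x then x else a1.
Definition retract2 (s : G) : G2 :=
  if sval (cid (p_surj s)) is inr y then y else a2.

Lemma p_paste : p (inl a1) = p (inr a2).
Proof. by apply/p_ident; apply: Or32. Qed.

Lemma retract1_inl x : retract1 (p (inl x)) = x.
Proof.
rewrite /retract1; case: cid => u /= /p_ident.
by case=> [->//|[_]//|[-> [->]]].
Qed.

Lemma retract1_inr y : retract1 (p (inr y)) = a1.
Proof.
rewrite /retract1; case: cid => u /= /p_ident.
by case=> [->//|[->]//|[->]].
Qed.

Lemma retract2_inl x : retract2 (p (inl x)) = a2.
Proof.
rewrite /retract2; case: cid => u /= /p_ident.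
by case=> [->//|[->]//|[->]].
Qed.

Lemma retract2_inr y : retract2 (p (inr y)) = y.
Proof.
rewrite /retract2; case: cid => u /= /p_ident.
by case=> [->//|[-> [->]]//|[_]].
Qed.

Definition retractE := (retract1_inl, retract1_inr, retract2_inl, retract2_inr).

(** Each step of the walk survives under one retraction and is contracted to a point by the
    other. *)
Lemma walk_retract n s t : walk n s t -> exists n1 n2, [/\ n1 + n2 = n,
  walk n1 (retract1 s) (retract1 t) & walk n2 (retract2 s) (retract2 t)].
Proof.
elim: n s => [|n IH] s /= => [->|[r /p_adj]]; first by exists 0, 0.
move=> [u [v [<- <-]]] uv /IH[n1 [n2 [<- w1 w2]]].
case: u v uv w1 w2 => [x|x] [y|y] //=; rewrite !retractE => xy w1 w2.
  by exists n1.+1, n2; split=> //; exists y.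
by exists n1, n2.+1; split=> //; [rewrite addnS|exists y].
Qed.

Lemma walk_inl n x y : walk n x y -> walk n (p (inl x)) (p (inl y)).
Proof.
elim: n x => [|n IH] x /= => [->//|[z xz /IH w]].
by exists (p (inl z)) => //; apply/p_adj; exists (inl x), (inl z).
Qed.

Lemma walk_inr n x y : walk n x y -> walk n (p (inr x)) (p (inr y)).
Proof.
elim: n x => [|n IH] x /= => [->//|[z xz /IH w]].
by exists (p (inr z)) => //; apply/p_adj; exists (inr x), (inr z).
Qed.

Lemma dist_pasting s t n1 n2 :
  dist (retract1 s) (retract1 t) = Some n1 ->
  dist (retract2 s) (retract2 t) = Some n2 ->
  dist s t = Some (n1 + n2).
Proof.
move=> d1 d2; apply/distP; split; last first.
  move=> m /walk_retract[m1 [m2 [<- w1 w2]]].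
  move/distP: d1 => [_ /(_ _ w1) le1]; move/distP: d2 => [_ /(_ _ w2) le2].
  exact: leq_add.
have [u us] := p_surj s; have [v vt] := p_surj t; subst s t.
(* On the same side, the other retraction contributes distance 0; on opposite sides, two shortest
   walks are joined at the pasting vertex. *)
case: u v d1 d2 => [x|x] [y|y]; rewrite !retractE.
- by move=> /distP[/walk_inl w _]; rewrite distxx => -[<-]; rewrite addn0.
- move=> /distP[/walk_inl w1 _] /distP[/walk_inr w2 _].
  by apply: walk_cat w1 _; rewrite p_paste.
- move=> /distP[/walk_inl w1 _] /distP[/walk_inr w2 _].
  by rewrite addnC; apply: walk_cat w2 _; rewrite -p_paste.
- by rewrite distxx => -[<-] /distP[/walk_inr w _].
Qed.

Lemma embeds_pasting (X1 X2 : Type) : embeds_in_hypercube G1 X1 ->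
  embeds_in_hypercube G2 X2 -> embeds_in_hypercube G (X1 + X2).
Proof.
move=> [f1 /isometricP iso1] [f2 /isometricP iso2].
exists (fun s => exist _ _ (finite_sumset (svalP (f1 (retract1 s)))
                                          (svalP (f2 (retract2 s))))).
apply/isometricP => s t /=; rewrite sumsetY ncard_sumset.
- exact: dist_pasting.
- exact: finite_setY_hypercube.
- exact: finite_setY_hypercube.
Qed.

(** * Restricting an embedding of the pasting to its factors *)

Section Factors.
Hypotheses (hG1 : partial_cube G1) (hG2 : partial_cube G2).
Variables (X : Type) (f : G -> hypercube X).
Hypothesis f_iso : isometric f.

(** On the image of [G1] the second retraction is constant, so it adds 0 to the distance. *)
Lemma isometric_inl : isometric (fun x => f (p (inl x))).
Proof.
move=> x y; have [n d] := partial_cube_dist x y hG1.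
rewrite f_iso d -[n]addn0; apply: dist_pasting; rewrite !retractE //.
exact: distxx.
Qed.

Lemma isometric_inr : isometric (fun y => f (p (inr y))).
Proof.
move=> x y; have [n d] := partial_cube_dist x y hG2.
rewrite f_iso d -[n]add0n; apply: dist_pasting; rewrite !retractE //.
exact: distxx.
Qed.

Lemma varying_disjoint x : varying (fun x => f (p (inl x))) a1 x ->
  varying (fun y => f (p (inr y))) a2 x -> False.
Proof.
move=> [u ux] [v vx].
have [n1 d1] := partial_cube_dist u a1 hG1.
have [n2 d2] := partial_cube_dist a2 v hG2.
have /isometricP iso1 := isometric_inl; have /isometricP iso2 := isometric_inr.
have d : dist (p (inl u)) (p (inr v)) = Some (n1 + n2).
  by apply: dist_pasting; rewrite !retractE.
move/isometricP: f_iso d => ->; move: d1 d2; rewrite iso1 iso2 -p_paste.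
rewrite -p_paste setYC in vx.
set A := _ `+` _ in ux *; set B := _ `+` _ in vx * => -[<-] [<-] [] E.
have finA : finite_set A by exact: finite_setY_hypercube.
have finB : finite_set B by exact: finite_setY_hypercube.
have finAB : finite_set (A `|` B) by rewrite finite_setU.
(* With [A] and [B] the differences from the pasting vertex to [u] and [v], the distance |A| + |B|
   is at most |A ∪ B|, which forces A ∩ B to be empty. *)
have := subset_ncard finAB (@setY_sub_setU _ _ _ _).
rewrite E -ncardUI // -[leqRHS]addn0 leq_add2l leqn0 => /eqP AB0.
have : (A `&` B) x by [].
by rewrite (ncard_eq0 _ AB0) //; exact: finite_setIl.
Qed.

End Factors.

End Pasting.

(** * Comparison of the isometric dimensions *)

Lemma card_le_setTP (T U : Type) :
  [set: T] #<= [set: U] <-> exists f : T -> U, injective f.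
Proof.
split=> [/card_leP[g]|[f fI]].
  exists (fun x => sval (g (exist _ x (in_setT x)))) => x y /sval_inj.
  by move/(@inj _ _ _ g) => /(_ (in_setT _) (in_setT _)) [].
have [g] : $|{injfun [set: T] >-> [set: U]}|; last exact: inj_card_le g.
by apply/injfunPex; exists f => // x y _ _; exact: fI.
Qed.

Theorem theorem7p2 (G1 G2 G : graph) (a1 : G1) (a2 : G2)
    (hG1 : partial_cube G1) (hG2 : partial_cube G2) (hG : partial_cube G)
    (pasting : vertex_pasting a1 a2 G) :
  ([set: dimI hG] #= [set: (dimI hG1 + dimI hG2)%type])%card.
Proof.
have [p [p_surj p_ident p_adj]] := pasting.
have [emb1 min1] := dimIP hG1; have [emb2 min2] := dimIP hG2.
have [[f isof] minG] := dimIP hG.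
rewrite card_eq_le; apply/andP; split.
  by apply: minG; exact: (embeds_pasting p_surj p_ident p_adj).
have iso1 := isometric_inl p_surj p_ident p_adj hG1 isof.
have iso2 := isometric_inr p_surj p_ident p_adj hG2 isof.
(* Minimality of each factor's dimension injects it into the coordinates of [f] varying over that
   factor. *)
have /card_le_setTP[i1 i1I] := min1 _ (embeds_in_varying a1 iso1).
have /card_le_setTP[i2 i2I] := min2 _ (embeds_in_varying a2 iso2).
have dis := varying_disjoint p_surj p_ident p_adj hG1 hG2 isof.
apply/card_le_setTP.
exists (fun z => match z with inl x => sval (i1 x) | inr y => sval (i2 y) end).
(* In the mixed cases a common value would be a coordinate varying over both factors. *)
move=> [x|y] [x'|y'] //= h.
- by congr inl; apply/i1I/sval_inj.
- by case: (dis (sval (i2 y'))); [rewrite -h|]; exact: svalP.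
- by case: (dis (sval (i1 x'))); [|rewrite -h]; exact: svalP.
- by congr inr; apply/i2I/sval_inj.
Qed.
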